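(* Assume $G$ satisfies the Plausibility Assumption. Let $S$ be a set of variables with $|S|\le\zeta\cdot\mathrm{SMALL}$. Then $\mathrm{cl}(S)$ is small and satisfies $R(\mathrm{cl}(S))\le|S|$.
   Context: Fix integers $K\ge3$, $3\le\tau\le K$. $G$ is a bipartite factor graph between $n$ variable-vertices and constraint-vertices, each constraint-vertex having between $\tau-1$ and $K$ neighbours. A subgraph is an edge-induced subgraph $H=G[A]$ (possibly empty, not necessarily connected); $\mathrm{vbls}(H),\mathrm{cons}(H)$ are its variable-/constraint-vertices, $N_H(f)$ the variables adjacent to $f$ in $H$. $H$ is a $\tau$-subgraph if $|N_H(f)|\ge\tau$ for all $f\in\mathrm{cons}(H)$; a leaf is a variable-vertex of degree $1$ in $H$. Parameters $1\le\mathrm{SMALL}\le n/2$, $0<\zeta<1$, $K\le\zeta\cdot\mathrm{SMALL}$; $H$ is small if $|\mathrm{cons}(H)|\le\mathrm{SMALL}$. For a $\tau$-subgraph $H$: credits $=$ number of leaves; debits $=\sum_{i}\max(\deg_H(i)-2,0)+\sum_{f}(|N_H(f)|-\tau)$; revenue $R(H)=$ credits $-$ debits; income $I(H)=R(H)-\zeta|\mathrm{cons}(H)|$; plausible means $I(H)\ge0$. Plausibility Assumption: every $\tau$-subgraph with at most $2\cdot\mathrm{SMALL}$ constraint-vertices is plausible. For a set $S$ of variables, $H$ is $S$-closed if it is a $\tau$-subgraph all of whose leaves lie in $S$; the closure $\mathrm{cl}(S)$ is the union of all small $S$-closed $\tau$-subgraphs. *)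

(* Defs.v *)
From HB Require Import structures.
From mathcomp Require Import all_boot all_order all_algebra.

Set Implicit Arguments.
Unset Strict Implicit.
Unset Printing Implicit Defensive.

Import Order.TTheory GRing.Theory Num.Theory.
Local Open Scope ring_scope.

(* A bipartite factor graph with variable-vertices V and constraint-vertices C
   is given by its edge set G : {set V * C}.  An edge-induced subgraph
   H = G[A] is identified with its edge set A; in particular unions of
   subgraphs are unions of edge sets. *)

Section FactorGraph.

Variables V C : finType.
Implicit Types (G H : {set V * C}) (S : {set V}).

Definition vbls H : {set V} := [set e.1 | e in H].

Definition cstrs H : {set C} := [set e.2 | e in H].

Definition nbrs H (f : C) : {set V} := [set i | (i, f) \in H].

Definition deg H (i : V) : nat := #|[set f | (i, f) \in H]|.

Definition leaves H : {set V} := [set i in vbls H | deg H i == 1%N].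

Definition factor_graph (K tau : nat) G : Prop :=
  forall f : C, (tau - 1 <= #|nbrs G f| <= K)%N.

Definition subgraph G H : bool := H \subset G.

Definition tau_subgraph (tau : nat) G H : bool :=
  subgraph G H && [forall f in cstrs H, (tau <= #|nbrs H f|)%N].

Definition credits H : int := #|leaves H|%:Z.

Definition debits (tau : nat) H : int :=
  \sum_(i in vbls H) Num.max ((deg H i)%:Z - 2) 0
  + \sum_(f in cstrs H) (#|nbrs H f|%:Z - tau%:Z).

Definition revenue (tau : nat) H : int := credits H - debits tau H.

Section Income.

Variable R : realFieldType.

Definition income (tau : nat) (zeta : R) H : R :=
  (revenue tau H)%:~R - zeta * #|cstrs H|%:R.

Definition plausible (tau : nat) (zeta : R) H : bool :=
  0 <= income tau zeta H.

Definition small (SMALL : R) H : bool := #|cstrs H|%:R <= SMALL.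

Definition plausibility_assumption (tau : nat) (SMALL zeta : R) G : Prop :=
  forall H, tau_subgraph tau G H -> #|cstrs H|%:R <= 2 * SMALL ->
    plausible tau zeta H.

Definition closed_subgraph (tau : nat) G S H : bool :=
  tau_subgraph tau G H && (leaves H \subset S).

Definition cl (tau : nat) (SMALL : R) G S : {set V * C} :=
  \bigcup_(H : {set V * C} | small SMALL H && closed_subgraph tau G S H) H.

End Income.

End FactorGraph.

(* Main.v *)
(* Leaves of a union are leaves of a part, so S-closed subgraphs are stable under
   union.  An S-closed H has R(H) <= |S|, since debits are nonnegative and
   credits count leaves in S.  If H1 and H2 are small and S-closed, their union
   has at most 2 SMALL constraints, so it is plausible, and
   zeta |cons| <= R <= |S| <= zeta SMALL makes it small again. *)

Require Import Defs.
From HB Require Import structures.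
From mathcomp Require Import all_boot all_order all_algebra.

Set Implicit Arguments.
Unset Strict Implicit.
Unset Printing Implicit Defensive.

Import Order.TTheory GRing.Theory Num.Theory.
Local Open Scope ring_scope.

Section Closed.

Variables V C : finType.
Implicit Types (G H : {set V * C}) (S : {set V}).

Lemma cstrsU H1 H2 : cstrs (H1 :|: H2) = cstrs H1 :|: cstrs H2.
Proof. exact: imsetU. Qed.

Lemma nbrsS H1 H2 f : H1 \subset H2 -> nbrs H1 f \subset nbrs H2 f.
Proof. by move/subsetP=> sH; apply/subsetP=> i; rewrite !inE => /sH. Qed.

Lemma degS H1 H2 i : H1 \subset H2 -> (deg H1 i <= deg H2 i)%N.
Proof.
by move/subsetP=> sH; apply/subset_leq_card/subsetP=> f; rewrite !inE => /sH.
Qed.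

Lemma deg_gt0 H i : i \in vbls H -> (0 < deg H i)%N.
Proof.
by case/imsetP=> -[j f] Hjf ->; apply/card_gt0P; exists f; rewrite inE.
Qed.

(** Degree is monotone in the edge set and positive on [vbls H1], so degree 1 in [H2] leaves only
    degree 1 in [H1]. *)
Lemma leaves_sub H1 H2 i :
  H1 \subset H2 -> i \in vbls H1 -> i \in leaves H2 -> i \in leaves H1.
Proof.
move=> sH iH1; rewrite !inE iH1 /= => /andP[_ /eqP d2].
by rewrite eqn_leq deg_gt0 // -d2 degS.
Qed.

Lemma leavesU H1 H2 : leaves (H1 :|: H2) \subset leaves H1 :|: leaves H2.
Proof.
apply/subsetP=> i iL; have: i \in vbls (H1 :|: H2) by case/setIdP: iL.
rewrite /vbls imsetU => /setUP[iH|iH]; apply/setUP; [left|right].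
  exact: leaves_sub (subsetUl _ _) iH iL.
exact: leaves_sub (subsetUr _ _) iH iL.
Qed.

Lemma tau_subgraphU tau G H1 H2 :
  tau_subgraph tau G H1 -> tau_subgraph tau G H2 ->
  tau_subgraph tau G (H1 :|: H2).
Proof.
case/andP=> sG1 /forall_inP t1 /andP[sG2 /forall_inP t2].
apply/andP; split; first by rewrite /subgraph subUset; apply/andP.
(* Whichever part contains [f] already gives it [tau] neighbours, and the union only adds more. *)
apply/forall_inP=> f; rewrite cstrsU => /setUP[/t1|/t2] /leq_trans; apply.
  exact/subset_leq_card/nbrsS/subsetUl.
exact/subset_leq_card/nbrsS/subsetUr.
Qed.

Lemma closed_subgraphU tau G S H1 H2 :
  closed_subgraph tau G S H1 -> closed_subgraph tau G S H2 ->
  closed_subgraph tau G S (H1 :|: H2).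
Proof.
case/andP=> t1 l1 /andP[t2 l2]; rewrite /closed_subgraph tau_subgraphU //=.
by apply: subset_trans (leavesU _ _) _; rewrite subUset l1.
Qed.

Lemma cstrs0 : cstrs (set0 : {set V * C}) = set0.
Proof. exact: imset0. Qed.

Lemma closed_subgraph0 tau G S : closed_subgraph tau G S set0.
Proof.
rewrite /closed_subgraph /tau_subgraph /subgraph sub0set cstrs0 /=.
apply/andP; split; first by apply/forall_inP=> f; rewrite inE.
by apply/subsetP=> i; rewrite inE /vbls imset0 inE.
Qed.

(** The variable terms are truncated at 0; the constraint terms are nonnegative by the degree
    condition of a [tau]-subgraph. *)
Lemma debits_ge0 tau G H : tau_subgraph tau G H -> 0 <= debits tau H.
Proof.
case/andP=> _ /forall_inP tH; apply: addr_ge0; apply: sumr_ge0 => x Hx.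
  by rewrite le_max lexx orbT.
by rewrite subr_ge0 lez_nat tH.
Qed.

Lemma revenue_closed tau G S H :
  closed_subgraph tau G S H -> revenue tau H <= #|S|%:Z.
Proof.
case/andP=> tH lH; apply: (@le_trans _ _ (credits H)).
  by rewrite gerBl (debits_ge0 tH).
by rewrite lez_nat subset_leq_card.
Qed.

Lemma closed_plausible_small (R : realFieldType) (SMALL zeta : R) tau G S H :
  0 < zeta -> #|S|%:R <= zeta * SMALL -> closed_subgraph tau G S H ->
  plausible tau zeta H -> small SMALL H.
Proof.
move=> z0 hS cH; rewrite /plausible /income subr_ge0 => pH.
rewrite /small -(ler_pM2l z0); apply: le_trans hS; apply: le_trans pH _.
(* Reading [#|S|] as the image of an integer moves the comparison from [R] to [int]. *)
by rewrite [leRHS]pmulrn ler_int (revenue_closed cH).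
Qed.

End Closed.

Theorem theorem5p7 (R : realFieldType) (V C : finType) (n K tau : nat)
    (SMALL zeta : R) (G : {set V * C}) (S : {set V})
    (hK : (3 <= K)%N) (htau : (3 <= tau <= K)%N)
    (hn : #|V| = n) (hG : factor_graph K tau G)
    (hSMALL : 1 <= SMALL <= n%:R / 2) (hzeta : 0 < zeta < 1)
    (hKS : K%:R <= zeta * SMALL)
    (hplaus : plausibility_assumption tau SMALL zeta G)
    (hS : #|S|%:R <= zeta * SMALL) :
  small SMALL (cl tau SMALL G S) /\
  revenue tau (cl tau SMALL G S) <= #|S|%:Z.
Proof.
have [z0 _] := andP hzeta; have [S1 _] := andP hSMALL.
have [sm clS] : small SMALL (cl tau SMALL G S) /\
    closed_subgraph tau G S (cl tau SMALL G S).
  (* Both properties are carried together: smallness of the two parts makes the assumption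
     applicable to their union, and closedness then restores smallness, so the size bound does not
     grow along the union. *)
  apply: (big_ind (fun H => small SMALL H /\ closed_subgraph tau G S H)).
  - split; last exact: closed_subgraph0.
    by rewrite /small cstrs0 cards0 (le_trans ler01).
  - move=> H1 H2 [s1 c1] [s2 c2].
    have c12 := closed_subgraphU c1 c2; split=> //.
    apply: (closed_plausible_small z0 hS c12); apply: hplaus.
      by case/andP: c12.
    (* Inclusion-exclusion: the constraints of the union number at most the sum of both counts. *)
    rewrite mulr_natl mulr2n; apply: le_trans (lerD s1 s2).
    by rewrite -natrD ler_nat cstrsU cardsU leq_subr.
  - by move=> H /andP.
by split=> //; apply: revenue_closed clS.
Qed.
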